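(* Let $E$ be a finite error group acting on the Hilbert space $H$ by its faithful irreducible unitary representation of degree $\sqrt{|E:Z(E)|}$, and let $S$ be a normal (not necessarily Abelian) subgroup of $E$. Let $\chi_1,\dots,\chi_t$ ($t\ge 1$) be distinct irreducible characters of $S$, each a constituent of the restriction to $S$ of the character of $E$ on $H$; write $\chi=\chi_1$, choose $h_1,\dots,h_t\in E$ with $\chi_i=\chi^{h_i}$, and put $B=\{h_1,\dots,h_t\}$. Let $T=\sum_{h\in B}P_{\chi^{h}}$, and for $h\in B$ let $W_h=P_{\chi^h}(H)$ with quasikernel $Z(W_h)$. Let $g\in E$. Then: (1) If $g\in\bigcap_{h\in B}Z(W_h)$, and $\lambda_g(h)\in\mathbb{C}$ denotes the scalar by which $g$ acts on $W_h$, then $g$ is detectable by the quantum code with projector $T$ if and only if $\lambda_g(h)$ takes the same value for all $h\in B$ (this common value then being $\phi(g)$). (2) If $g\notin S$, then $g$ is detectable by the quantum code with projector $T$ if and only if $[\chi^{hg},\chi^{h'}]=0$ for all $h,h'\in B$. (3) If $g\in S$ and $g\notin\bigcap_{h\in B}Z(W_h)$, then $g$ is not detectable by the quantum code with projector $T$.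
   Context: Nice error basis: for a finite group $G$ of order $N^2$, a set of unitary $N\times N$ matrices $\{D(x): x\in G\}$ with $D(1)=I$, $\operatorname{Trace} D(x)=0$ for $x\ne 1$, and $D(x)D(y)=\omega(x,y)D(xy)$ for scalars $\omega(x,y)\in\mathbb{C}$. An error group $E$ is the (finite) group generated by such matrices under multiplication; it has a faithful irreducible complex representation of degree $\sqrt{|E:Z(E)|}$, where $Z(E)$ is the center. Elements of $E$ are identified with the unitary operators by which they act on $H=\mathbb{C}^{N}$, $N=\sqrt{|E:Z(E)|}$. The index group $E/Z(E)$ need not be Abelian. For a normal subgroup $S$ of $E$, an irreducible complex character $\psi$ of $S$, and $h\in E$, the conjugate character is $\psi^h(s)=\psi(hsh^{-1})$ for $s\in S$ (so $(\psi^h)^g=\psi^{hg}$). By Clifford's theorem the irreducible constituents of the restriction to $S$ of the character of $E$ on $H$ are all conjugate to each other under $E$. For an irreducible character $\psi$ of $S$, $P_\psi=\frac{\psi(1)}{|S|}\sum_{s\in S}\psi(s^{-1})\,s$, regarded as an operator on $H$; it is the orthogonal projector onto the $\psi$-isotypic component of $H$, and it is nonzero exactly when $\psi$ is a constituent of the restriction to $S$ of the character of $E$ on $H$. The image of a nonzero $P_\psi$ is a Clifford code; the image of $T$ is a direct sum of translates of a Clifford code. The quasikernel $Z(W_h)$ is the set of all $g$ in the inertia group $\{g\in E:\chi^{hg}=\chi^h\}$ of $\chi^h$ for which there is $\lambda\in\mathbb{C}$ with $gv=\lambda v$ for all $v\in W_h$. $[\alpha,\beta]=\frac{1}{|S|}\sum_{s\in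 S}\alpha(s)\overline{\beta(s)}$ is the usual inner product of characters of $S$. An error $g\in E$ is detectable by the quantum code with projector $T$ if there is $\phi(g)\in\mathbb{C}$ such that $TgT=\phi(g)T$.
   Formalization: In (2) it is additionally assumed that g is not in S·Z(E), or that g is not in all the quasikernels Z(W_h); without this (2) fails, e.g. for the real Pauli group of order 8 with S=1, t=1, g=-1, which is detectable although [χ^g,χ]=1. *)

(* Defs.v *)
From HB Require Import structures.
From mathcomp Require Import all_boot all_order all_algebra.
From mathcomp Require Import all_fingroup all_solvable all_character.
From mathcomp Require Import reals complex.

Set Implicit Arguments.
Unset Strict Implicit.
Unset Printing Implicit Defensive.

Import GroupScope Order.TTheory GRing.Theory Num.Theory.
Local Open Scope ring_scope.

Section ErrorGroups.

Variable C : numClosedFieldType.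

Definition nice_error_basis (G : finGroupType) (N : nat) (D : G -> 'M[C]_N) :
    Prop :=
  [/\ #|G| = (N ^ 2)%N,
      forall x : G, D x \is unitarymx,
      D 1%g = 1%:M,
      forall x : G, x != 1%g -> \tr (D x) = 0
    & exists omega : G -> G -> C,
        forall x y : G, D x *m D y = omega x y *: D (x * y)%g].

(* E is isomorphic, via the faithful representation r, to the matrix group
   generated by the matrices D x; e x is the element of E with matrix D x. *)
Definition error_group (gT : finGroupType) (E : {group gT}) : Prop :=
  exists (N : nat) (r : mx_representation C E N)
         (G : finGroupType) (D : G -> 'M[C]_N) (e : G -> gT),
    [/\ nice_error_basis D,
        mx_faithful r,
        forall x : G, r (e x) = D x
      & E = <<[set e x | x : G]>>%g :> {set gT}].

Section Characters.

Variables (gT : finGroupType) (S : {group gT}).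

(* Class functions on S are represented by functions on the ambient type gT;
   only their values on S are meaningful. Characters take values in an
   arbitrary C here, whereas 'CF(S) and irr S are tied to algC. *)
Implicit Types psi alpha beta : gT -> C.

Definition irreducible_char psi : Prop :=
  exists (n : nat) (r : mx_representation C S n),
    mx_irreducible r /\ {in S, forall s, psi s = \tr (r s)}.

(* psi^h, a right action: (psi^h)^g = psi^(h * g). Beware that psi^h applies
   psi to h s h^-1, whereas s ^ h in MathComp stands for h^-1 s h. *)
Definition conj_char psi (h : gT) : gT -> C :=
  fun s => psi (h * s * h^-1)%g.

Definition char_dot alpha beta : C :=
  #|S|%:R^-1 * \sum_(s in S) alpha s * (beta s)^*.

End Characters.

Section Codes.

Variables (gT : finGroupType) (E S : {group gT}) (N : nat).
Variable rE : mx_representation C E N.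
Implicit Type psi : gT -> C.

(* The space H is 'cV[C]_N, on which g in E acts by v |-> rE g *m v. *)

Definition constituent psi : Prop :=
  char_dot S (fun s => \tr (rE s)) psi != 0.

Definition char_proj psi : 'M[C]_N :=
  (psi 1%g / #|S|%:R) *: \sum_(s in S) psi (s^-1)%g *: rE s.

(* v belongs to W_psi, the image of the projector P_psi *)
Definition in_code psi (v : 'cV[C]_N) : Prop :=
  exists u : 'cV[C]_N, v = char_proj psi *m u.

Definition acts_by_scalar psi (g : gT) (lambda : C) : Prop :=
  forall v : 'cV[C]_N, in_code psi v -> rE g *m v = lambda *: v.

Definition in_inertia psi (g : gT) : Prop :=
  g \in E /\ {in S, conj_char psi g =1 psi}.

Definition in_quasikernel psi (g : gT) : Prop :=
  in_inertia psi g /\ exists lambda : C, acts_by_scalar psi g lambda.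

Definition sum_proj psi (B : {set gT}) : 'M[C]_N :=
  \sum_(h in B) char_proj (conj_char psi h).

Definition detects (T : 'M[C]_N) (g : gT) (phi : C) : Prop :=
  T *m rE g *m T = phi *: T.

Definition detectable (T : 'M[C]_N) (g : gT) : Prop :=
  exists phi : C, detects T g phi.

End Codes.

End ErrorGroups.

(* Main.v *)
(* Each P_psi is an idempotent, P_psi P_psi' = 0 for distinct irreducible psi and
   psi', and P_psi g = g P_(psi^g); hence P_psi g P_psi' = 0 exactly when psi^g and
   psi' are distinct, i.e. orthogonal. Cutting T g T = phi T down to two blocks
   gives P_h g P_h' = phi P_h P_h'. If g lies in S Z(E), it fixes every chi^h and
   commutes with every P_h, so detectability forces g to act as phi on every W_h.
   Otherwise no s g with s in S is central; since the trace on H vanishes off Z(E)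
   (this is the degree condition), tr (P_h g) = 0, hence phi = 0 and all the blocks
   P_h g P_h' vanish. *)
Require Import Defs.
From HB Require Import structures.
From mathcomp Require Import all_boot all_order all_algebra.
From mathcomp Require Import all_fingroup all_solvable all_character.
From mathcomp Require Import reals complex.

Set Implicit Arguments.
Unset Strict Implicit.
Unset Printing Implicit Defensive.

Import GroupScope Order.TTheory GRing.Theory Num.Theory.
Local Open Scope ring_scope.

(** * Schur's lemma and averaging over the group *)

Section Schur.

Variables (F : fieldType) (gT : finGroupType) (G : {group gT}) (n m : nat).
Variables (r : mx_representation F G n) (r' : mx_representation F G m).

(** The kernel and the row space of [M] are submodules, so irreducibility makes [M] both row free
    and row full, hence square and invertible. *)
Lemma intertwiner_rsim (M : 'M[F]_(n, m)) :
  mx_irreducible r -> mx_irreducible r' ->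
  {in G, forall x, r x *m M = M *m r' x} -> M != 0 -> mx_rsim r r'.
Proof.
move=> /mx_irrP[_ irr] /mx_irrP[_ irr'] cM nzM.
have freeM : row_free M.
  rewrite -kermx_eq0; apply: contraR nzM => nz_ker.
  have /irr/(_ nz_ker) full : mxmodule r (kermx M).
    apply/mxmoduleP => x Gx; apply/sub_kermxP.
    by rewrite -mulmxA cM // mulmxA mulmx_ker mul0mx.
  by rewrite -submx0 -[M]mul1mx submx0; apply/eqP/sub_kermxP/submx_full.
have fullM : row_full M.
  have /irr' fullM : mxmodule r' <<M>>%MS.
    rewrite (eqmx_module r' (genmxE M)); apply/mxmoduleP => x Gx.
    by rewrite -cM // submxMl.
  by rewrite /row_full -mxrank_gen [_ == _]fullM // -mxrank_eq0 mxrank_gen mxrank_eq0.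
apply: (MxReprSim _ freeM cM).
by rewrite -(eqP (freeM : \rank M == n)) (eqP (fullM : \rank M == m)).
Qed.

(** The sum is left undivided by the group order; that factor resurfaces in
    [irr_char_convolution]. *)
Definition mx_avg (A : 'M[F]_(n, m)) : 'M_(n, m) :=
  \sum_(s in G) r s^-1%g *m A *m r' s.

Lemma mx_avg_intertwines A : {in G, forall x, r x *m mx_avg A = mx_avg A *m r' x}.
Proof.
move=> x Gx; rewrite mulmx_sumr mulmx_suml [LHS](reindex_inj (mulIg x)) /=.
apply: eq_big => s; first by rewrite groupMr.
rewrite groupMr // => Gs.
by rewrite !mulmxA -repr_mxM ?groupV ?groupM // invMg mulKVg repr_mxM ?mulmxA.
Qed.

(* The (i, j) matrix coefficients are the (i, j) entries of the averages of the
   elementary matrices, so the average controls the convolution of traces. *)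
Lemma sum_trace_mul_avg x : x \in G ->
  \sum_(s in G) \tr (r s^-1%g) * \tr (r' (x * s)%g) =
  \sum_i \sum_j mx_avg (delta_mx i j *m r' x) i j.
Proof.
move=> Gx; under [RHS]eq_bigr => i _ do under eq_bigr => j _ do rewrite summxE.
under [RHS]eq_bigr => i _ do rewrite exchange_big /=.
rewrite [RHS]exchange_big /=; apply: eq_bigr => s Gs.
rewrite /mxtrace mulr_suml; apply: eq_bigr => i _.
rewrite mulr_sumr; apply: eq_bigr => j _.
rewrite repr_mxM // mulmxA -(mulmxA _ (r' x)) -repr_mxM // !mxE.
rewrite (bigD1 j) //= big1 ?addr0 => [|k k'j].
  rewrite !mxE (bigD1 i) //= big1 ?addr0 => [|k k'i]; first by rewrite mxE !eqxx mulr1.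
  by rewrite mxE (negPf k'i) mulr0.
rewrite !mxE big1 ?mul0r // => l _.
by rewrite mxE (negPf k'j) andbF mulr0.
Qed.

End Schur.

(** * Orthogonality relations for irreducible characters *)

Section Characters.

Variables (C : numClosedFieldType) (gT : finGroupType) (S : {group gT}).
Implicit Types (psi : gT -> C).

Lemma card_group_neq0 : #|S|%:R != 0 :> C.
Proof. by rewrite pnatr_eq0 -lt0n cardG_gt0. Qed.

Lemma irr_degree_neq0 n (r : mx_representation C S n) :
  mx_irreducible r -> n%:R != 0 :> C.
Proof. by case/mx_irrP => n_gt0 _; rewrite pnatr_eq0 -lt0n. Qed.

Lemma irr_cent_scalar n (r : mx_representation C S n) (A : 'M[C]_n) :
  mx_irreducible r -> {in S, forall x, r x *m A = A *m r x} ->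
  A = (\tr A / n%:R)%:M.
Proof.
move=> irr cA; have nz_n := irr_degree_neq0 irr.
have /is_scalar_mxP[a ->] : is_scalar_mx A.
  apply: (mx_abs_irr_cent_scalar (group_closure_closed_field irr)).
  by apply/centgmxP => x Sx; rewrite cA.
by rewrite mxtrace_scalar -(mulr_natr a) mulfK.
Qed.

Lemma irreducible_char1_neq0 psi : irreducible_char S psi -> psi 1%g != 0.
Proof.
case=> n [r [irr def_psi]].
by rewrite def_psi // repr_mx1 mxtrace1 (irr_degree_neq0 irr).
Qed.

(** By Schur's lemma each average is a scalar matrix, determined by its trace. Only the terms with
    [i = j] survive, and the trace of [delta_mx i i *m r x] is the entry [(i, i)] of [r x]. *)
Lemma irr_char_convolution psi x : irreducible_char S psi -> x \in S ->
  \sum_(s in S) psi s^-1%g * psi (x * s)%g = #|S|%:R / psi 1%g * psi x.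
Proof.
case=> n [r [irr def_psi]] Sx; have nz_n := irr_degree_neq0 irr.
rewrite !def_psi // repr_mx1 mxtrace1.
under eq_bigr => s Ss do rewrite !def_psi ?groupV ?groupM //.
rewrite (sum_trace_mul_avg r r Sx).
have avgE A : mx_avg r r A = (#|S|%:R / n%:R * \tr A)%:M.
  rewrite [LHS](irr_cent_scalar irr) //; last exact: mx_avg_intertwines.
  rewrite raddf_sum /= (eq_bigr (fun=> \tr A)) => [|s Ss].
    by rewrite sumr_const -(mulr_natl (\tr A)) mulrAC.
  by rewrite mxtrace_mulC mulmxA repr_mxV // mulmxV ?repr_mx_unit ?mul1mx.
rewrite [in RHS]/mxtrace mulr_sumr; apply: eq_bigr => i _.
rewrite (bigD1 i) //= big1 => [|j j'i]; rewrite avgE mxE; last first.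
  by rewrite eq_sym (negPf j'i).
rewrite eqxx addr0; congr (_ * _).
rewrite /mxtrace (bigD1 i) //= big1 ?addr0 => [|k k'i]; rewrite !mxE.
  rewrite (bigD1 i) //= big1 ?addr0 => [|k k'i]; rewrite mxE ?eqxx ?mul1r //.
  by rewrite (negPf k'i) andbF mul0r.
by rewrite big1 // => l _; rewrite mxE (negPf k'i) mul0r.
Qed.

(** A nonzero average would be an intertwiner making [r] and [r'] similar, and similar
    representations have equal traces. *)
Lemma irr_char_convolution_neq psi psi' x :
  irreducible_char S psi -> irreducible_char S psi' ->
  ~ {in S, psi =1 psi'} -> x \in S ->
  \sum_(s in S) psi s^-1%g * psi' (x * s)%g = 0.
Proof.
case=> [n [r [irr def_psi]]] [n' [r' [irr' def_psi']]] neq Sx.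
under eq_bigr => s Ss do rewrite def_psi ?def_psi' ?groupV ?groupM //.
rewrite (sum_trace_mul_avg r r' Sx); apply: big1 => i _; apply: big1 => j _.
have [-> | nzM] := eqVneq (mx_avg r r' (delta_mx i j *m r' x)) 0.
  by rewrite mxE.
case: neq => s Ss; rewrite def_psi ?def_psi' //; apply: mxtrace_rsim => //.
by apply: intertwiner_rsim nzM => //; apply: mx_avg_intertwines.
Qed.

Local Open Scope sesquilinear_scope.

(* [\sum_s r s (r s)^*] is an invariant positive definite Hermitian form. *)
Lemma mxtrace_repr_inv n (r : mx_representation C S n) x : x \in S ->
  \tr (r x^-1%g) = (\tr (r x))^*.
Proof.
move=> Sx; pose H : 'M[C]_n := \sum_(s in S) r s *m (r s)^t*.
have invH : r x *m H *m (r x)^t* = H.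
  rewrite /H mulmx_sumr mulmx_suml [RHS](reindex_inj (mulgI x)) /=.
  apply: eq_big => s; first by rewrite groupMl.
  by move=> Ss; rewrite repr_mxM // trmx_mul map_mxM /= !mulmxA.
have unitH : H \in unitmx.
  rewrite -row_free_unit -kermx_eq0; apply/rowV0P => v /sub_kermxP vH0.
  have: \sum_(s in S) dotmx (v *m r s) (v *m r s) = 0.
    have := congr1 (fun A => (A *m v^t*) 0 0) vH0.
    rewrite mul0mx [RHS]mxE /H mulmx_sumr mulmx_suml summxE; apply: etrans; apply: eq_bigr => s Ss.
    by rewrite dotmxE trmx_mul map_mxM /= !mulmxA.
  move/psumr_eq0P => /(_ (fun s _ => dnorm_ge0 _ _)) /(_ 1%g (group1 S)) /eqP.
  by rewrite dnorm_eq0 repr_mx1 mulmx1 => /eqP.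
(* Invariance makes [r x^-1] similar, through [H], to the conjugate transpose of [r x]. *)
have commH : r x^-1%g *m H = H *m (r x)^t*.
  by rewrite -{1}invH !mulmxA -repr_mxM ?groupV // mulVg repr_mx1 mul1mx.
rewrite -[r _](mulmxK unitH) commH.
by rewrite mxtrace_mulC mulmxA mulVmx // mul1mx trace_map_mx mxtrace_tr.
Qed.

Lemma irreducible_char_inv psi x : irreducible_char S psi -> x \in S ->
  psi x^-1%g = (psi x)^*.
Proof.
by case=> n [r [_ def_psi]] Sx; rewrite !def_psi ?groupV // mxtrace_repr_inv.
Qed.

Lemma irreducible_char_class psi x y : irreducible_char S psi ->
  x \in S -> y \in S -> psi (y * x * y^-1)%g = psi x.
Proof.
case=> n [r [_ def_psi]] Sx Sy; rewrite !def_psi ?groupM ?groupV //.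
by rewrite !repr_mxM ?groupM ?groupV // mxtrace_mulC mulmxA repr_mxV // mulVmx ?repr_mx_unit ?mul1mx.
Qed.

Lemma eq_char_dot alpha alpha' beta beta' :
  {in S, alpha =1 alpha'} -> {in S, beta =1 beta'} ->
  char_dot S alpha beta = char_dot S alpha' beta' :> C.
Proof.
move=> eq_a eq_b; congr (_ * _); apply: eq_bigr => s Ss.
by rewrite eq_a ?eq_b.
Qed.

Lemma char_dot_irr psi : irreducible_char S psi -> char_dot S psi psi = 1.
Proof.
move=> irr; rewrite /char_dot.
(* Conjugate values are values at inverses, so the inner product is a convolution at [1]. *)
under eq_bigr => s Ss do rewrite -irreducible_char_inv // mulrC -[s in X in _ * X]mul1g.
rewrite irr_char_convolution // divfK ?irreducible_char1_neq0 //.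
by rewrite mulVf ?card_group_neq0.
Qed.

Lemma char_dot_irr_neq psi psi' :
  irreducible_char S psi -> irreducible_char S psi' ->
  ~ {in S, psi =1 psi'} -> char_dot S psi psi' = 0.
Proof.
move=> irr irr' neq; rewrite /char_dot.
under eq_bigr => s Ss do rewrite -irreducible_char_inv // mulrC -[s in X in _ * X]mul1g.
rewrite irr_char_convolution_neq ?mulr0 // => eq_psi.
by apply: neq => s Ss; rewrite eq_psi.
Qed.

Lemma char_dot_irr_eq0 psi psi' :
  irreducible_char S psi -> irreducible_char S psi' ->
  char_dot S psi psi' = 0 <-> ~ {in S, psi =1 psi'}.
Proof.
move=> irr irr'; split=> [dot0 eq_psi | ]; last exact: char_dot_irr_neq.
have /eqP := dot0; rewrite (eq_char_dot (fun _ _ => erefl) (beta' := psi)).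
  by rewrite char_dot_irr ?oner_eq0.
by move=> s Ss; rewrite eq_psi.
Qed.

(** Twisting [r] by conjugation only permutes the matrices [r s], so the submodules stay the
    same. *)
Lemma irreducible_char_conj psi h :
  irreducible_char S psi -> h \in 'N(S) -> irreducible_char S (conj_char psi h).
Proof.
case=> n [r [/mx_irrP[n_gt0 irr] def_psi]] nSh.
have conjS s : s \in S -> (s ^ h^-1)%g \in S by rewrite memJ_norm ?groupV.
have reprJ : mx_repr S (fun s => r (s ^ h^-1)%g).
  by split=> [|x y Sx Sy]; rewrite ?conj1g ?repr_mx1 // conjMg repr_mxM ?conjS.
exists n, (MxRepresentation reprJ); split; last first.
  by move=> s Ss; rewrite /conj_char -mulgA -{1}[h]invgK -conjgE def_psi ?conjS.
apply/mx_irrP; split=> // U /mxmoduleP modU; apply: irr.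
apply/mxmoduleP => x Sx; have := modU (x ^ h)%g.
by rewrite /= conjgK memJ_norm // => /(_ Sx).
Qed.

End Characters.

(** * Products, conjugates and traces of the projectors *)

Section Projectors.

Variables (C : numClosedFieldType) (gT : finGroupType) (E S : {group gT}).
Variables (N : nat) (rE : mx_representation C E N).
Hypothesis nSE : S <| E.
Implicit Types (psi : gT -> C).

Let SE : {subset S <= E} := subsetP (normal_sub nSE).

Local Notation P := (char_proj S rE).

Lemma conj_charM psi h g :
  {in S, conj_char (conj_char psi h) g =1 conj_char psi (h * g)%g}.
Proof. by move=> s _; rewrite /conj_char invMg !mulgA. Qed.

Lemma eq_char_proj psi psi' : {in S, psi =1 psi'} -> P psi = P psi'.
Proof.
move=> eq_psi; rewrite /char_proj eq_psi //; congr (_ *: _).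
by apply: eq_bigr => s Ss; rewrite eq_psi ?groupV.
Qed.

Lemma char_proj_conj psi g : g \in E ->
  rE g *m P psi = P (conj_char psi g^-1%g) *m rE g.
Proof.
move=> Eg; have nSg : g \in 'N(S) by apply: (subsetP (normal_norm nSE)).
have conj1 : conj_char psi g^-1%g 1%g = psi 1%g by rewrite /conj_char mulg1 mulgV.
rewrite /char_proj conj1 -scalemxAr -scalemxAl; congr (_ *: _).
rewrite mulmx_sumr mulmx_suml [RHS](reindex_inj (conjg_inj g^-1%g)) /=.
apply: eq_big => s; first by rewrite memJ_norm ?groupV.
move=> Ss; have Es := SE Ss; rewrite -scalemxAr -scalemxAl /conj_char.
rewrite -conjVg [(s^-1 ^ _)%g]conjgE !invgK mulKg mulgKV -!repr_mxM ?groupJ ?groupV //.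
by rewrite conjgE invgK -!mulgA mulVg mulg1.
Qed.

Lemma char_proj_conjr psi g : g \in E ->
  P psi *m rE g = rE g *m P (conj_char psi g).
Proof.
move=> Eg; rewrite char_proj_conj //; congr (_ *m _); apply: eq_char_proj.
by move=> s _; rewrite /conj_char invgK !mulgA mulgV mul1g mulgK.
Qed.

(** The products [s t] are collected by their value [u], so that [t^-1 = u^-1 s]; the coefficients
    are then convolutions at [u^-1]. *)
Lemma char_proj_mul psi psi' :
  P psi *m P psi' = (psi 1%g / #|S|%:R * (psi' 1%g / #|S|%:R)) *:
    \sum_(u in S) (\sum_(s in S) psi s^-1%g * psi' (u^-1 * s)%g) *: rE u.
Proof.
rewrite /char_proj -scalemxAl -scalemxAr scalerA; congr (_ *: _).
under [RHS]eq_bigr => u _ do rewrite scaler_suml.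
rewrite exchange_big mulmx_suml; apply: eq_bigr => s Ss /=.
rewrite mulmx_sumr [RHS](reindex_inj (mulgI s)) /=.
apply: eq_big => u; first by rewrite groupMl.
move=> Su; rewrite -scalemxAl -scalemxAr scalerA repr_mxM ?SE //.
by rewrite invMg mulgKV.
Qed.

Lemma char_proj_idem psi : irreducible_char S psi -> P psi *m P psi = P psi.
Proof.
move=> irr; rewrite char_proj_mul.
under eq_bigr => u Su do rewrite irr_char_convolution ?groupV // -scalerA.
rewrite -scaler_sumr scalerA; congr (_ *: _).
have := card_group_neq0 C S; have := irreducible_char1_neq0 irr.
by move=> nz1 nzS; rewrite !mulrA divfK // mulfK.
Qed.

Lemma char_proj_orth psi psi' :
  irreducible_char S psi -> irreducible_char S psi' ->
  ~ {in S, psi =1 psi'} -> P psi *m P psi' = 0.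
Proof.
move=> irr irr' neq; rewrite char_proj_mul big1 ?scaler0 // => u Su.
by rewrite irr_char_convolution_neq ?groupV // scale0r.
Qed.

(** The trace is the degree of [psi] times its multiplicity in [H]; this is how [constituent] yields
    a nonzero projector. *)
Lemma mxtrace_char_proj psi : irreducible_char S psi ->
  \tr (P psi) = psi 1%g * char_dot S (fun s => \tr (rE s)) psi.
Proof.
move=> irr; rewrite mxtraceZ raddf_sum /= -mulrA; congr (_ * (_ * _)).
apply: eq_bigr => s Ss.
by rewrite mxtraceZ (irreducible_char_inv irr Ss) mulrC.
Qed.

Lemma mxtrace_char_proj_neq0 psi :
  irreducible_char S psi -> constituent S rE psi -> \tr (P psi) != 0.
Proof.
by move=> irr con; rewrite mxtrace_char_proj // mulf_neq0 ?(irreducible_char1_neq0 irr).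
Qed.

Lemma char_proj_neq0 psi :
  irreducible_char S psi -> constituent S rE psi -> P psi != 0.
Proof.
move=> irr /(mxtrace_char_proj_neq0 irr).
by apply: contra_neq => ->; rewrite mxtrace0.
Qed.

Lemma compression_eq0 psi psi' g :
  irreducible_char S psi -> irreducible_char S psi' -> P psi' != 0 -> g \in E ->
  P psi *m rE g *m P psi' = 0 <-> ~ {in S, conj_char psi g =1 psi'}.
Proof.
move=> irr irr' nzP Eg.
have irrg : irreducible_char S (conj_char psi g).
  by apply: irreducible_char_conj => //; apply: (subsetP (normal_norm nSE)).
rewrite char_proj_conjr // -mulmxA; split=> [P0 eq_psi | neq]; last first.
  by rewrite char_proj_orth ?mulmx0.
(* Were the two characters equal, cancelling the invertible [rE g] would leave [P psi' = 0]. *)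
case/negP: nzP; apply/eqP/(can_inj (mulKmx (repr_mx_unit rE Eg))).
by rewrite mulmx0 -[RHS]P0 (eq_char_proj eq_psi) char_proj_idem.
Qed.

Lemma acts_by_scalarP psi g lambda :
  acts_by_scalar S rE psi g lambda <-> rE g *m P psi = lambda *: P psi.
Proof.
split=> [act | act _ [u ->]]; last by rewrite mulmxA act scalemxAl.
(* The [j]-th basis vector picks out column [j] of [P psi]. *)
apply/matrixP => i j; pose u : 'cV[C]_N := delta_mx j 0.
have /act/matrixP/(_ i 0) : in_code S rE psi (P psi *m u) by exists u.
by rewrite /u mulmxA -!colE [LHS]mxE [RHS]mxE [X in _ * X]mxE => ->; rewrite [RHS]mxE.
Qed.

End Projectors.

(* [\sum_x |tr x|^2 = |E|], and the centre alone contributes [|Z(E)| N^2 = |E|]. *)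
Lemma mxtrace_central_type (C : numClosedFieldType) (gT : finGroupType)
    (E : {group gT}) (N : nat) (rE : mx_representation C E N) x :
  mx_irreducible rE -> (N ^ 2)%N = #|E : 'Z(E)|%g ->
  x \in E -> x \notin 'Z(E)%g -> \tr (rE x) = 0.
Proof.
move=> irr degN Ex Z'x; pose tr2 y := \tr (rE y) * (\tr (rE y))^*.
have irrE : irreducible_char E (fun y => \tr (rE y)) by exists N, rE.
have sumE : \sum_(y in E) tr2 y = #|E|%:R.
  have /(congr1 (fun c => #|E|%:R * c)) := char_dot_irr irrE.
  by rewrite /char_dot mulVKf ?card_group_neq0 // mulr1.
have sumZ : \sum_(y in 'Z(E)) tr2 y = #|E|%:R.
  rewrite (eq_bigr (fun=> (N ^ 2)%:R)) => [|z Zz].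
    by rewrite sumr_const -(mulr_natr _%:R) -natrM degN mulnC Lagrange ?center_sub.
  have Ez : z \in E by apply: subsetP Zz; apply: center_sub.
  have scalZ y : y \in 'Z(E)%g -> exists a, rE y = a%:M.
    case/centerP => Ey cEy; exists (\tr (rE y) / N%:R).
    by apply: irr_cent_scalar irr _ => u Eu; rewrite -!repr_mxM // cEy.
  have [[a def_a] [b def_b]] := (scalZ z Zz, scalZ z^-1%g (groupVr Zz)).
  (* The trace at [z^-1] is the conjugate of the trace at [z], so [a b = 1] gives [tr2 z = N^2]. *)
  have ab1 : a * b = 1.
    apply: (mulIf (irr_degree_neq0 irr)); rewrite !mulr_natr -!mxtrace_scalar.
    by rewrite scalar_mxM -def_a -def_b repr_mxV ?mulmxV ?repr_mx_unit.
  rewrite /tr2 -mxtrace_repr_inv // def_a def_b !mxtrace_scalar.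
  by rewrite -(mulr_natr a) -(mulr_natr b) mulrACA ab1 mul1r -natrM.
have : \sum_(y in E :\: 'Z(E)) tr2 y = 0.
  apply: (addrI #|E|%:R); rewrite addr0 -{2}sumE [RHS](big_setID 'Z(E)%g) /=.
  by rewrite (setIidPr (center_sub E)) sumZ.
move/psumr_eq0P => /(_ (fun y _ => mul_conjC_ge0 _)) /(_ x).
rewrite inE Z'x Ex => /(_ isT) /eqP.
by rewrite mul_conjC_eq0 => /eqP.
Qed.

Lemma mxtrace_char_proj_mul (C : numClosedFieldType) (gT : finGroupType)
    (E S : {group gT}) (N : nat) (rE : mx_representation C E N) (psi : gT -> C) g :
  S <| E -> mx_irreducible rE -> (N ^ 2)%N = #|E : 'Z(E)|%g ->
  g \in E -> g \notin (S * 'Z(E))%g -> \tr (char_proj S rE psi *m rE g) = 0.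
Proof.
move=> nSE irrE degN Eg notSZg; rewrite -scalemxAl mxtraceZ mulmx_suml raddf_sum /=.
rewrite big1 ?mulr0 // => s Ss; have Es := subsetP (normal_sub nSE) s Ss.
rewrite -scalemxAl mxtraceZ -repr_mxM //.
rewrite (mxtrace_central_type irrE degN) ?mulr0 //; first exact: groupM.
by apply: contra notSZg => Zsg; rewrite -[g](mulKg s) mem_mulg ?groupV.
Qed.

(** * Detectability block by block *)

Section Detection.

Variables (C : numClosedFieldType) (gT : finGroupType) (E S : {group gT}).
Variables (N : nat) (rE : mx_representation C E N) (chi : gT -> C) (B : {set gT}).
Hypothesis nSE : S <| E.

Local Notation psi h := (conj_char chi h).
Local Notation P h := (char_proj S rE (psi h)).
Local Notation T := (sum_proj S rE chi B).

Hypothesis irr : {in B, forall h, irreducible_char S (psi h)}.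
Hypothesis con : {in B, forall h, constituent S rE (psi h)}.
Hypothesis neq : {in B &, forall h h', {in S, psi h =1 psi h'} -> h = h'}.

(** By [neq], distinct elements of [B] index orthogonal projectors, so only the term [h] of [T]
    survives. *)
Lemma char_proj_sum_proj h : h \in B -> P h *m T = P h.
Proof.
move=> Bh; rewrite mulmx_sumr (bigD1 h) //= big1 => [|h' /andP[Bh' h'h]].
  by rewrite addr0 char_proj_idem //; apply: irr.
apply: char_proj_orth => //; try exact: irr.
by move=> eq_psi; case/eqP: h'h; apply: neq => // s Ss; rewrite eq_psi.
Qed.

Lemma sum_proj_char_proj h : h \in B -> T *m P h = P h.
Proof.
move=> Bh; rewrite mulmx_suml (bigD1 h) //= big1 => [|h' /andP[Bh' h'h]].
  by rewrite addr0 char_proj_idem //; apply: irr.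
apply: char_proj_orth => //; try exact: irr.
by move=> eq_psi; case/eqP: h'h; apply: neq.
Qed.

Lemma detects_block g phi h h' : detects rE T g phi -> h \in B -> h' \in B ->
  P h *m rE g *m P h' = phi *: (P h *m P h').
Proof.
move=> det Bh Bh'.
rewrite -{1}(char_proj_sum_proj Bh) -{1}(sum_proj_char_proj Bh').
transitivity (P h *m (T *m rE g *m T) *m P h'); first by rewrite !mulmxA.
have projT : P h *m (phi *: T) = phi *: P h.
  by rewrite -scalemxAr char_proj_sum_proj.
by rewrite det projT scalemxAl.
Qed.

(** An element of the inertia group commutes with [P h], so the diagonal block [P h g P h] is just
    [g P h]. *)
Lemma detects_acts_by_scalar g phi h :
  detects rE T g phi -> h \in B -> in_inertia E S (psi h) g ->
  acts_by_scalar S rE (psi h) g phi.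
Proof.
move=> det Bh [Eg stab]; have irr_h := irr Bh; apply/acts_by_scalarP.
rewrite -[in RHS](char_proj_idem _ nSE irr_h) -(detects_block det Bh Bh).
by rewrite char_proj_conjr // (eq_char_proj _ stab) -mulmxA char_proj_idem.
Qed.

Lemma acts_by_scalar_detects g phi :
  (forall h, h \in B -> acts_by_scalar S rE (psi h) g phi) -> detects rE T g phi.
Proof.
move=> act; rewrite /detects -mulmxA mulmx_sumr mulmx_sumr scaler_sumr.
apply: eq_bigr => h Bh; rewrite (proj1 (acts_by_scalarP _ _ _ _ _) (act h Bh)).
by rewrite -scalemxAr sum_proj_char_proj.
Qed.

Lemma detects_scalar_eq g phi lambda h : detects rE T g phi -> h \in B ->
  acts_by_scalar S rE (psi h) g lambda -> lambda = phi.
Proof.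
move=> det Bh /acts_by_scalarP act; have irr_h := irr Bh.
have /eqP := detects_block det Bh Bh.
rewrite -mulmxA act -scalemxAr char_proj_idem // -subr_eq0 -scalerBl scaler_eq0.
by rewrite (negPf (char_proj_neq0 irr_h (con Bh))) orbF subr_eq0 => /eqP.
Qed.

Lemma in_inertia_mul_center g h : h \in B -> g \in (S * 'Z(E))%g ->
  in_inertia E S (psi h) g.
Proof.
move=> Bh /mulsgP[s z Ss /centerP[Ez cEz] ->]; have Es := subsetP (normal_sub nSE) s Ss.
split=> [|x Sx]; first exact: groupM.
rewrite -[RHS](irreducible_char_class (irr Bh) Sx Ss) [LHS]/conj_char.
have Ex := subsetP (normal_sub nSE) x Sx.
by rewrite invMg !mulgA -(mulgA s z x) cEz // !mulgA mulgK.
Qed.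

Lemma detects_notin_mul_center g phi h : h \in B ->
  mx_irreducible rE -> (N ^ 2)%N = #|E : 'Z(E)|%g ->
  g \in E -> g \notin (S * 'Z(E))%g -> detects rE T g phi -> phi = 0.
Proof.
move=> Bh irrE degN Eg notSZg det; have irr_h := irr Bh.
(* By cyclicity the left trace is that of [P h g], which vanishes; the right one is [phi] times the
   nonzero trace of [P h]. *)
have := congr1 mxtrace (detects_block det Bh Bh).
rewrite mxtrace_mulC mulmxA !char_proj_idem // mxtrace_char_proj_mul // mxtraceZ.
move/esym/eqP; rewrite mulf_eq0 => /orP[/eqP // |].
by rewrite (negPf (mxtrace_char_proj_neq0 irr_h (con Bh))).
Qed.

Lemma compression_char_dot g h h' : g \in E -> h \in B -> h' \in B ->
  P h *m rE g *m P h' = 0 <->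
  char_dot S (psi (h * g)%g) (psi h') = 0.
Proof.
move=> Eg Bh Bh'; have [irr_h irr_h'] := (irr Bh, irr Bh').
rewrite (compression_eq0 nSE irr_h irr_h' (char_proj_neq0 irr_h' (con Bh')) Eg).
rewrite -(eq_char_dot (conj_charM _ _ _) (fun _ _ => erefl)).
symmetry; apply: char_dot_irr_eq0 => //; apply: irreducible_char_conj => //.
exact: (subsetP (normal_norm nSE)).
Qed.

Lemma detects0P g : g \in E ->
  detects rE T g 0 <->
  (forall h h', h \in B -> h' \in B -> char_dot S (psi (h * g)%g) (psi h') = 0).
Proof.
move=> Eg; split=> [det h h' Bh Bh' | dot0].
  by apply/compression_char_dot; rewrite // (detects_block det) // scale0r.
rewrite /detects scale0r mulmx_suml mulmx_suml big1 // => h Bh.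
rewrite mulmx_sumr big1 // => h' Bh'.
by apply/compression_char_dot => //; apply: dot0.
Qed.

End Detection.

(** * The three detectability criteria *)

Theorem mainTheorem1 (R : realType) (gT : finGroupType) (E S : {group gT})
    (N : nat) (rE : mx_representation R[i] E N)
    (t : nat) (chis : 'I_t.+1 -> gT -> R[i]) (hs : 'I_t.+1 -> gT) (g : gT) :
  error_group R[i] E ->
  mx_faithful rE ->
  mx_irreducible rE ->
  (forall x : gT, x \in E -> rE x \is unitarymx) ->
  (N ^ 2)%N = #|E : 'Z(E)|%g ->
  S <| E ->
  (forall i, irreducible_char S (chis i)) ->
  (forall i j, i != j -> ~ {in S, chis i =1 chis j}) ->
  (forall i, constituent S rE (chis i)) ->
  (forall i, hs i \in E) ->
  (forall i, {in S, chis i =1 conj_char (chis ord0) (hs i)}) ->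
  g \in E ->
  let chi := chis ord0 in
  let B := [set hs i | i : 'I_t.+1] in
  let T := sum_proj S rE chi B in
  let in_all_quasikernels :=
    forall h, h \in B -> in_quasikernel S rE (conj_char chi h) g in
  [/\ in_all_quasikernels ->
      forall lambda : gT -> R[i],
        (forall h, h \in B ->
           acts_by_scalar S rE (conj_char chi h) g (lambda h)) ->
        (detectable rE T g <->
           forall h h', h \in B -> h' \in B -> lambda h = lambda h')
        /\ (forall phi : R[i], detects rE T g phi ->
              forall h, h \in B -> lambda h = phi),
      g \notin S ->
      (g \notin (S * 'Z(E))%g \/ ~ in_all_quasikernels) ->
      (detectable rE T g <->
         forall h h', h \in B -> h' \in B ->
           char_dot S (conj_char chi (h * g)%g) (conj_char chi h') = 0)
    & g \in S -> ~ in_all_quasikernels -> ~ detectable rE T g].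
Proof.
move=> _ _ irrE _ degN nSE irr neq con Ehs def_chi Eg chi B T all_qk.
have Bhs i : hs i \in B by apply: imset_f.
have irrB : {in B, forall h, irreducible_char S (conj_char chi h)}.
  move=> _ /imsetP[i _ ->]; apply: irreducible_char_conj (irr _) _.
  exact: (subsetP (normal_norm nSE)).
have conB : {in B, forall h, constituent S rE (conj_char chi h)}.
  move=> _ /imsetP[i _ ->]; rewrite /constituent.
  by rewrite -(eq_char_dot (fun _ _ => erefl) (def_chi i)); apply: con.
(* Equal conjugates of [chi] come from the same index, as the [chis] are pairwise distinct. *)
have neqB : {in B &, forall h h',
    {in S, conj_char chi h =1 conj_char chi h'} -> h = h'}.
  move=> _ _ /imsetP[i _ ->] /imsetP[j _ ->] eq_ij; congr hs; apply/eqP.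
  case: eqP => // /eqP i'j; case: (neq i j i'j) => s Ss.
  by rewrite !def_chi //; apply: eq_ij.
(* Used contrapositively: an element fixing every [chi^h] but outside some quasikernel cannot be
   detected. *)
have det_qk phi : detects rE T g phi ->
    (forall h, h \in B -> in_inertia E S (conj_char chi h) g) -> all_qk.
  move=> det stab h Bh; split; first exact: stab.
  by exists phi; apply: (detects_acts_by_scalar nSE irrB neqB det Bh (stab h Bh)).
have inertiaSZ : g \in (S * 'Z(E))%g ->
    forall h, h \in B -> in_inertia E S (conj_char chi h) g.
  by move=> SZg h Bh; apply: (in_inertia_mul_center nSE irrB).
split.
- move=> _ lambda act; have eq_phi phi : detects rE T g phi ->
    forall h, h \in B -> lambda h = phi.
    by move=> det h Bh; apply: (detects_scalar_eq nSE irrB conB neqB det Bh (act h Bh)).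
  split=> //; split=> [[phi det] h h' Bh Bh' | eq_lambda].
    by rewrite !(eq_phi phi).
  (* [B] contains [hs ord0], whose scalar serves as the common value. *)
  exists (lambda (hs ord0)); apply: acts_by_scalar_detects => // h Bh.
  by rewrite (eq_lambda (hs ord0) h) //; apply: act.
(* The disjunction excludes, for instance, a central [g] outside [S]: it acts on [H] as a scalar,
   hence is detectable, yet [chi^(h g) = chi^h] has inner product 1 with itself. *)
- move=> _ notSZ_or_qk; split=> [[phi det] | dot0]; last first.
    by exists 0; apply/(detects0P nSE irrB conB neqB Eg).
  suff phi0 : phi = 0 by apply/(detects0P nSE irrB conB neqB Eg); rewrite -phi0.
  have [SZg | notSZg] := boolP (g \in (S * 'Z(E))%g).
    (* Inside [S Z(E)], detection would put [g] in all quasikernels, against the other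
       alternative. *)
    by case: notSZ_or_qk => [| []]; [rewrite SZg | apply: det_qk det (inertiaSZ SZg)].
  exact: (detects_notin_mul_center nSE irrB conB neqB (Bhs ord0) irrE degN Eg notSZg).
- move=> Sg not_qk [phi det]; apply: not_qk; apply: (det_qk _ det).
  by apply: inertiaSZ; rewrite -[g]mulg1 mem_mulg.
Qed.
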